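(* Let $n\ge 3$ and let $\Gamma(D_{2n})$ be the incidence system defined in the context. If $n>3$, then $\Gamma(D_{2n})$ is an incidence geometric representation for the dihedral group $D_{2n}$ of order $2n$. If $n=3$, then $\Gamma(D_6)$ is a weak incidence geometric representation for $D_6$.
   Context: An incidence system is a quadruple $\Gamma=(X,*,t,I)$ where $X$ is a set of elements, $I$ a finite set of types, $t:X\to I$ a surjective type function, and $*$ a symmetric binary relation on $X$ (incidence) such that no two elements of the same type are incident. A correlation of $\Gamma$ is a permutation $\alpha$ of $X$ such that for all $x,y\in X$: $t(x)=t(y)\iff t(\alpha(x))=t(\alpha(y))$, and $x*y\iff \alpha(x)*\alpha(y)$. The correlations form a group $\mathrm{Aut}(\Gamma)$; its normal subgroup of correlations with $t(\alpha(x))=t(x)$ for all $x$ is denoted $\mathrm{Aut}_I(\Gamma)$. For groups $H\le K$, an incidence geometric representation for the pair $(H,K)$ is an incidence system $\Gamma$ together with isomorphisms $\varphi_1:H\to\mathrm{Aut}_I(\Gamma)$ and $\varphi_2:K\to\mathrm{Aut}(\Gamma)$ such that $\varphi_2|_H=\varphi_1$ (with $\mathrm{Aut}_I(\Gamma)\subseteq \mathrm{Aut}(\Gamma)$ the inclusion). An incidence geometric representation for a group $G$ is one for the pair $(\mathrm{Inn}(G),\mathrm{Aut}(G))$. If $\varphi_1,\varphi_2$ are only required to be injective homomorphisms (with the same compatibility), the representation is called weak. Construction of $\Gamma(D_{2n})$. Identify the vertex set $V$ of the $n$-gon with $\mathbb{Z}_n$. Let $\tau(n)=\{k: 1\le k\le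 n-1,\ \gcd(k,n)=1\}$, and for $k\in\tau(n)$ let $E_k=\{\{x,x+k\}: x\in\mathbb{Z}_n\}$ (so $E_k=E_{n-k}$). Let $\bar\tau(n)=\{k\in\tau(n): k<n-k\}$ (one representative of each pair $\{k,n-k\}$). If $n$ is odd: the elements are $V\sqcup\bigsqcup_{k\in\bar\tau(n)}E_k$, the type set is $\{0\}\cup\bar\tau(n)$, vertices have type $0$ and elements of $E_k$ have type $k$; a vertex $v$ and an element $e\in E_k$ are incident iff $v\in e$; any $e\in E_i$ and $f\in E_j$ with $i\ne j$ are incident; there are no other incidences. If $n$ is even: let $V_0$ be the even residues and $V_{-1}$ the odd residues in $\mathbb{Z}_n$. The elements are $V_{-1}\sqcup V_0\sqcup\bigsqcup_{k\in\bar\tau(n)}E_k$, the type set is $\{-1,0\}\cup\bar\tau(n)$, elements of $V_{-1}$, $V_0$, $E_k$ have types $-1$, $0$, $k$ respectively; a vertex $v$ and $e\in E_k$ are incident iff $v\in e$; any $e\in E_i$, $f\in E_j$ with $i\neq j$ are incident; every element of $V_0$ is incident to every element of $V_{-1}$; there are no other incidences. *)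

(* Defs.v *)
From mathcomp Require Import all_boot all_order all_algebra all_fingroup all_solvable.
Set Implicit Arguments.
Unset Strict Implicit.
Unset Printing Implicit Defensive.

(* An incidence system on the finite element set X is given by a type
   function typ : X -> I (I = the image of typ, so typ is surjective onto I)
   and a symmetric incidence relation inc. *)
Section Correlations.
Variables (X : finType) (I : eqType) (typ : X -> I) (inc : rel X).

Definition is_correlation (a : {perm X}) : bool :=
  [forall x, forall y, (typ x == typ y) == (typ (a x) == typ (a y))] &&
  [forall x, forall y, inc x y == inc (a x) (a y)].

Definition AutGamma : {set {perm X}} := [set a | is_correlation a].

Definition AutIGamma : {set {perm X}} :=
  [set a in AutGamma | [forall x, typ (a x) == typ x]].

End Correlations.

(* incidence geometric representation for a pair (H, K) of groups H <= K,
   both subgroups of some finGroupType gT: isomorphisms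
   phi1 : H -> Aut_I(Gamma), phi2 : K -> Aut(Gamma) with phi2|_H = phi1.
   Since phi1 is determined by phi2, we quantify over phi2 only and require
   that its restriction to H is an isomorphism onto Aut_I(Gamma). *)
Definition inc_geom_rep_pair (gT : finGroupType) (H K : {set gT})
    (X : finType) (I : eqType) (typ : X -> I) (inc : rel X) : Prop :=
  H \subset K /\
  exists phi2 : gT -> {perm X},
    [/\ {in K &, {morph phi2 : x y / (x * y)%g}},
        {in K &, injective phi2},
        phi2 @: K = AutGamma typ inc
      & phi2 @: H = AutIGamma typ inc].

Definition weak_inc_geom_rep_pair (gT : finGroupType) (H K : {set gT})
    (X : finType) (I : eqType) (typ : X -> I) (inc : rel X) : Prop :=
  H \subset K /\
  exists phi2 : gT -> {perm X},
    [/\ {in K &, {morph phi2 : x y / (x * y)%g}},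
        {in K &, injective phi2},
        phi2 @: K \subset AutGamma typ inc
      & phi2 @: H \subset AutIGamma typ inc].

Definition Inn (gT : finGroupType) (G : {group gT}) : {set {perm gT}} :=
  [set conj_aut G x | x in G].

Definition inc_geom_rep (gT : finGroupType) (G : {group gT})
    (X : finType) (I : eqType) (typ : X -> I) (inc : rel X) : Prop :=
  inc_geom_rep_pair (Inn G) (Aut G) typ inc.

Definition weak_inc_geom_rep (gT : finGroupType) (G : {group gT})
    (X : finType) (I : eqType) (typ : X -> I) (inc : rel X) : Prop :=
  weak_inc_geom_rep_pair (Inn G) (Aut G) typ inc.

(* vertices of the n-gon: Z_n, represented by 'I_n *)
Lemma ord_pos (n : nat) (x : 'I_n) : 0 < n.
Proof. by apply: leq_ltn_trans (ltn_ord x). Qed.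

Definition addZn (n : nat) (x : 'I_n) (k : nat) : 'I_n :=
  Ordinal (ltn_pmod (x + k) (ord_pos x)).

Definition tau (n k : nat) : bool := [&& 1 <= k, k <= n - 1 & coprime k n].
Definition taubar (n k : nat) : bool := tau n k && (k < n - k).

Definition Eset (n k : nat) : {set {set 'I_n}} :=
  [set [set x; addZn x k] | x : 'I_n].

(* ambient type: vertices (inl) or 2-subsets of Z_n (inr) *)
Definition is_elem (n : nat) (z : 'I_n + {set 'I_n}) : bool :=
  match z with
  | inl _ => true
  | inr e => [exists k : 'I_n, taubar n k && (e \in Eset n k)]
  end.

Definition Elt (n : nat) : finType := {z : 'I_n + {set 'I_n} | @is_elem n z}.

(* type of an edge e: the (unique) k in taubar(n) with e in E_k *)
Definition edge_type (n : nat) (e : {set 'I_n}) : int :=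
  if [pick k : 'I_n | taubar n k && (e \in Eset n k)] is Some k
  then Posz k else Posz 0.

Definition typD (n : nat) (x : Elt n) : int :=
  match val x with
  | inl v => if odd n then Posz 0 else (if odd v then (- 1 : int)%R else Posz 0)
  | inr e => edge_type e
  end.

Definition incD (n : nat) : rel (Elt n) := fun x y =>
  match val x, val y with
  | inl v, inr e => v \in e
  | inr e, inl v => v \in e
  | inr _, inr _ => typD x != typD y
  | inl _, inl _ => ~~ odd n && (typD x != typD y)
  end.

Definition Dih (n : nat) : {group dihedral_gtype (2 * n)} :=
  [set: dihedral_gtype (2 * n)]%G.

(* Main.v *)
(** Affine maps [v |-> b + u * v] of Z_n, with [u] a unit, act on both sides.

    On the geometry they are correlations, carrying E_k to E_(u k). Conversely,
    once a correlation is known to send vertices to vertices (this is where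
    [n > 3] enters), it maps the n-cycle E_1 onto the n-cycle of some E_k, so
    the steps between images of consecutive vertices are all k or all -k and
    the vertex map is affine; edges are determined by their vertices.

    On the group, label the reflections by Z_n as [y * x ^+ v]. An automorphism
    sends x to a generator x^u and y to a reflection y x^b, so it permutes the
    reflections by an affine map, and all affine maps arise in this way.

    Finally, inner automorphisms and type-preserving correlations both
    correspond to [u = 1] or [u = -1] with [b] in 2 Z_n. *)

Require Import Defs.
From mathcomp Require Import all_boot all_order all_algebra all_fingroup all_solvable.
From mathcomp Require Import zify ring.
Set Implicit Arguments.
Unset Strict Implicit.
Unset Printing Implicit Defensive.
Import GRing.Theory.

Lemma coprime_subl (a b : nat) : a <= b -> coprime (b - a) b = coprime a b.
Proof.
move=> /subnK E; rewrite /coprime -E; move: (b - a) => c.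
by rewrite addnK gcdnDl gcdnDr gcdnC.
Qed.

(** * Edges and types of the polygon system *)

Section Polygon.

(** Writing [n] as [m.+3] makes ['I_n] the ring of residues modulo [n] and builds in [n >= 3]; the
    condition [n > 3] becomes [0 < m]. *)
Variable m : nat.
Local Notation n := m.+3.
Local Notation Zn := 'I_m.+3.
Local Notation Corr := (AutGamma (@typD n) (@incD n)).
Local Open Scope ring_scope.

Lemma unitZnE (k : Zn) : (k \is a GRing.unit) = coprime k n.
Proof. by rewrite coprime_sym. Qed.

Lemma odd_Zn_add (x y : Zn) : ~~ odd n -> odd (x + y)%R = odd x (+) odd y.
Proof. by move=> /negbTE n_even; rewrite /= odd_mod // oddD. Qed.

Lemma odd_Zn_mul (x y : Zn) : ~~ odd n -> odd (x * y)%R = odd x && odd y.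
Proof. by move=> /negbTE n_even; rewrite /= odd_mod // oddM. Qed.

Lemma odd_Zn_unit (u : Zn) : ~~ odd n -> u \is a GRing.unit -> odd u.
Proof.
rewrite unitZnE => n_even; apply: contraLR => u_even.
apply/negP => /eqP co; have : (2 %| gcdn u n)%N by rewrite dvdn_gcd !dvdn2 u_even.
by rewrite co.
Qed.

Lemma unit_Zn_neq0 (u : Zn) : u \is a GRing.unit -> u != 0.
Proof. by apply: contraTneq => ->; rewrite unitr0. Qed.

Lemma Zn_natr_neq0 (k : nat) : (0 < k < n)%N -> k%:R != 0 :> Zn.
Proof. by case/andP=> k_gt0 k_lt; rewrite Zp_nat -val_eqE /= modn_small // -lt0n. Qed.

Lemma unit2_Zn : odd n -> 2%:R \is a @GRing.unit Zn.
Proof. by move=> n_odd; rewrite unitZnE Zp_nat /= modn_small ?coprime2n. Qed.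

(** The base point [x] is [y] or [y + l], and since [k] is nonzero [x + k] must be the other
    endpoint. A 2-set thus determines its step up to sign. *)
Lemma set2_step (x y k l : Zn) : k != 0 ->
  [set x; x + k] = [set y; y + l] -> k = l \/ k = - l.
Proof.
move=> k_neq0 /setP E.
have := E x; have := E (x + k); rewrite !inE !eqxx orbT /= => /esym Ek /esym Ex.
case/orP: Ex Ek => /eqP ->.
  rewrite -[X in _ == X]addr0 !(inj_eq (addrI y)) (negPf k_neq0) /=.
  by move/eqP; left.
rewrite -addrA -[X in _ == X]addr0 !(inj_eq (addrI y)) -[X in _ || (_ == X)]addr0.
rewrite (inj_eq (addrI l)) (negPf k_neq0) orbF addrC addr_eq0 => /eqP.
by right.
Qed.

(* The representative of {k, -k} in taubar; this is the type of {x, x + k}. *)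
Definition short_step (k : Zn) : Zn := if (k < n - k)%N then k else - k.

Lemma short_stepP (k : Zn) :
  k \is a GRing.unit -> taubar n (short_step k) /\ (0 < short_step k)%N.
Proof.
move=> kU; have k_neq0 := unit_Zn_neq0 kU; rewrite unitZnE in kU.
have k_gt0 : (0 < k)%N by rewrite lt0n.
have k_lt := ltn_ord k; rewrite /short_step /taubar /tau.
case: (ltnP k (n - k)) => hk; first by rewrite kU hk k_gt0; split=> //; lia.
have kE : val (- k) = (n - k)%N by rewrite /= modn_small //; lia.
rewrite -[nat_of_ord (- k)]/(val (- k)) kE.
(* A tie [k = n - k] would make [k] a common divisor of [k] and [n], so [k = 1] and [n = 2]. *)
have k2 : n <> (2 * k)%N.
  move=> nk; have : (k %| gcdn k n)%N.
    by rewrite dvdn_gcd dvdnn; apply/dvdnP; exists 2.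
  by rewrite (eqP kU) dvdn1 => /eqP; lia.
rewrite coprime_subl ?(ltnW k_lt) // kU.
by split; lia.
Qed.

Lemma short_step_eq (k l : Zn) :
  k \is a GRing.unit -> l \is a GRing.unit ->
  (short_step k == short_step l) = (k == l) || (k == - l).
Proof.
move=> kU lU; have [/andP[_ hk] _] := short_stepP kU.
have [/andP[_ hl] _] := short_stepP lU.
apply/eqP/orP => [|[]/eqP ->] //.
  rewrite /short_step; case: ifP => _; case: ifP => _.
  - by move->; left.
  - by move->; right.
  - by move=> <-; right; rewrite opprK.
  - by move/oppr_inj->; left.
have l_neq0 := unit_Zn_neq0 lU.
have l_gt0 : (0 < l)%N by rewrite lt0n.
move: hl; rewrite /short_step opprK; have l_lt := ltn_ord l.
have kE : val (- l) = (n - l)%N by rewrite /= modn_small //; lia.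
rewrite -[nat_of_ord (- l)]/(val (- l)) kE.
case: (ltnP (n - l)) => h1; case: (ltnP l (n - l)) => h2 //; first by lia.
(* Both tests fail only if [l = n - l], which [hl] excludes. *)
rewrite -[nat_of_ord (- l)]/(val (- l)) kE; lia.
Qed.

Lemma addZnE (x k : Zn) : addZn x k = x + k.
Proof. exact: val_inj. Qed.

Lemma short_step_edge (x k : Zn) : [set x; x + k] \in Eset n (short_step k).
Proof.
rewrite /short_step; case: ifP => _; apply/imsetP.
  by exists x; rewrite ?addZnE.
by exists (x + k); rewrite ?addZnE // addrK setUC.
Qed.

Lemma taubar_short (k : Zn) :
  taubar n k -> k \is a GRing.unit /\ short_step k = k.
Proof. by rewrite unitZnE /short_step => /andP[/and3P[_ _ ->] ->]. Qed.

Lemma edge_is_elem (x k : Zn) :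
  k \is a GRing.unit -> is_elem (inr [set x; x + k] : Zn + {set Zn}).
Proof.
move=> kU; apply/existsP; exists (short_step k).
by rewrite short_step_edge (short_stepP kU).1.
Qed.

(** The [pick] in [edge_type] has a single possible answer: any candidate equals [k] or [-k] by
    [set2_step], and [taubar] holds one of the two. *)
Lemma edge_typeE (x k : Zn) : k \is a GRing.unit ->
  edge_type [set x; x + k] = Posz (short_step k).
Proof.
move=> kU; rewrite /edge_type; case: pickP => [l|]; last first.
  by move/(_ (short_step k)); rewrite short_step_edge (short_stepP kU).1.
case/andP=> /taubar_short[lU lE] /imsetP[y _]; rewrite addZnE.
move/(set2_step (unit_Zn_neq0 kU)) => kl; congr (Posz (nat_of_ord _)).
by apply/eqP; rewrite -lE eq_sym short_step_eq //; case: kl => /eqP->; rewrite ?orbT.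
Qed.

Definition vtx (v : Zn) : Elt n := exist (@is_elem n) (inl v) isT.

(** Any unit is allowed as a step, not only representatives in [taubar], so that multiplying a step
    by a unit requires no normalisation. Each edge then has the two names [(x, k)] and
    [(x + k, -k)]. *)
Definition edge (x k : Zn) (kU : k \is a GRing.unit) : Elt n :=
  exist (@is_elem n) (inr [set x; x + k]) (edge_is_elem x kU).

Variant Elt_spec : Elt n -> Prop :=
  | EltVtx v : Elt_spec (vtx v)
  | EltEdge x k (kU : k \is a GRing.unit) : Elt_spec (edge x kU).

Lemma EltP (z : Elt n) : Elt_spec z.
Proof.
case: z => [[v|e] ez].
  by rewrite (_ : exist _ _ _ = vtx v); [constructor | apply: val_inj].
have /existsP[k /andP[/taubar_short[kU _] /imsetP[x _]]] := ez.
rewrite addZnE => ee.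
rewrite (_ : exist _ _ _ = edge x kU); first by constructor.
by apply: val_inj; rewrite /= ee.
Qed.

Lemma vtx_inj : injective vtx.
Proof. by move=> v w []. Qed.

Lemma typD_vtx (v : Zn) :
  typD (vtx v) = if odd n then Posz 0 else if odd v then -1 else Posz 0.
Proof. by []. Qed.

Lemma typD_edge (x k : Zn) (kU : k \is a GRing.unit) :
  typD (edge x kU) = Posz (short_step k).
Proof. exact: edge_typeE. Qed.

Lemma typ_vtx (v w : Zn) :
  (typD (vtx v) == typD (vtx w)) = odd n || (odd v == odd w).
Proof. by rewrite !typD_vtx; case: (odd n); case: (odd v); case: (odd w). Qed.

Lemma typ_vtx_edge (v x k : Zn) (kU : k \is a GRing.unit) :
  (typD (vtx v) == typD (edge x kU)) = false.
Proof.
rewrite typD_vtx typD_edge; have [_] := short_stepP kU.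
by case: (nat_of_ord (short_step k)) => // a _; case: (odd n); case: (odd v).
Qed.

Lemma typ_edge_vtx (v x k : Zn) (kU : k \is a GRing.unit) :
  (typD (edge x kU) == typD (vtx v)) = false.
Proof. by rewrite eq_sym typ_vtx_edge. Qed.

Lemma typ_edge (x y k l : Zn) (kU : k \is a GRing.unit) (lU : l \is a GRing.unit) :
  (typD (edge x kU) == typD (edge y lU)) = (k == l) || (k == - l).
Proof. by rewrite !typD_edge -short_step_eq. Qed.

(** With [inc_edge], this reduces incidence between two vertices or two edges to a comparison of
    types, leaving only vertex-edge incidence to be checked separately. *)
Lemma inc_vtx (v w : Zn) :
  incD (vtx v) (vtx w) = ~~ (typD (vtx v) == typD (vtx w)).
Proof.
rewrite typ_vtx negb_or -[LHS]/(~~ odd n && (typD (vtx v) != typD (vtx w))).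
by rewrite typ_vtx negb_or andbA andbb.
Qed.

Lemma inc_edge (x y k l : Zn) (kU : k \is a GRing.unit) (lU : l \is a GRing.unit) :
  incD (edge x kU) (edge y lU) = ~~ (typD (edge x kU) == typD (edge y lU)).
Proof. by []. Qed.

Lemma inc_vtx_edge (v x k : Zn) (kU : k \is a GRing.unit) :
  incD (vtx v) (edge x kU) = (v \in [set x; x + k]).
Proof. by []. Qed.

Lemma inc_sym (z z' : Elt n) : incD z z' = incD z' z.
Proof.
case: (EltP z) => [v|x k kU]; case: (EltP z') => [w|y l lU] //.
- by rewrite !inc_vtx eq_sym.
- by rewrite !inc_edge eq_sym.
Qed.

(** * Affine correlations *)

Definition affine (u b v : Zn) : Zn := b + u * v.

Lemma affine_inj (u b : Zn) : u \is a GRing.unit -> injective (affine u b).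
Proof. by move=> uU v w /addrI /(mulrI uU). Qed.

Lemma odd_affine (u b v : Zn) : ~~ odd n -> u \is a GRing.unit ->
  odd (affine u b v) = odd b (+) odd v.
Proof.
move=> n_even uU.
by rewrite [LHS](odd_Zn_add b (u * v) n_even) odd_Zn_mul ?(odd_Zn_unit _ uU).
Qed.

Definition affine_raw (u b : Zn) (z : Zn + {set Zn}) : Zn + {set Zn} :=
  match z with inl v => inl (affine u b v) | inr e => inr (affine u b @: e) end.

Lemma affine_edge (u b x k : Zn) :
  affine u b @: [set x; x + k] = [set affine u b x; affine u b x + u * k].
Proof. by rewrite imsetU1 imset_set1 /affine; congr [set _; _]; ring. Qed.

Lemma affine_elem (u b : Zn) (z : Elt n) :
  u \is a GRing.unit -> is_elem (affine_raw u b (val z)).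
Proof.
move=> uU; case: (EltP z) => [v|x k kU] //; rewrite [val _]/= [affine_raw _ _ _]/=.
by rewrite affine_edge edge_is_elem // unitrM uU.
Qed.

Definition affine_elt (u b : Zn) (uU : u \is a GRing.unit) (z : Elt n) : Elt n :=
  exist (@is_elem n) _ (affine_elem b z uU).

Lemma affine_elt_vtx (u b : Zn) uU v : @affine_elt u b uU (vtx v) = vtx (affine u b v).
Proof. exact: val_inj. Qed.

Lemma unit_mul (u k : Zn) :
  u \is a GRing.unit -> k \is a GRing.unit -> u * k \is a GRing.unit.
Proof. by rewrite unitrM => -> ->. Qed.

Lemma affine_elt_edge (u b : Zn) (uU : u \is a GRing.unit) x k (kU : k \is a GRing.unit) :
  affine_elt b uU (edge x kU) = edge (affine u b x) (unit_mul uU kU).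
Proof. by apply: val_inj; rewrite /= affine_edge. Qed.

Lemma affine_elt_inj (u b : Zn) (uU : u \is a GRing.unit) : injective (affine_elt b uU).
Proof.
have raw_inj : injective (affine_raw u b).
  move=> [v|e] [w|e'] // E.
    have {}E := congr1 (fun z => if z is inl v' then v' else 0) E.
    by rewrite (affine_inj uU E).
  have {}E := congr1 (fun z => if z is inr f then f else set0) E.
  by rewrite (imset_inj (affine_inj uU) E).
by move=> z z' [] /raw_inj /val_inj.
Qed.

Definition affine_perm (u b : Zn) (uU : u \is a GRing.unit) : {perm Elt n} :=
  perm (@affine_elt_inj u b uU).

Lemma affine_perm_vtx (u b : Zn) (uU : u \is a GRing.unit) v :
  affine_perm b uU (vtx v) = vtx (affine u b v).
Proof. by rewrite permE affine_elt_vtx. Qed.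

Lemma affine_perm_edge (u b : Zn) (uU : u \is a GRing.unit) x k
    (kU : k \is a GRing.unit) :
  affine_perm b uU (edge x kU) = edge (affine u b x) (unit_mul uU kU).
Proof. by rewrite permE affine_elt_edge. Qed.

Lemma AutGammaP (p : {perm Elt n}) :
  reflect ((forall z z', (typD z == typD z') = (typD (p z) == typD (p z'))) /\
           (forall z z', incD z z' = incD (p z) (p z')))
          (p \in Corr).
Proof.
rewrite inE; apply: (iffP andP) => [] [] ht hi; split.
- by move=> z z'; move/forallP/(_ z)/forallP/(_ z')/eqP: ht.
- by move=> z z'; move/forallP/(_ z)/forallP/(_ z')/eqP: hi.
- by apply/forallP=> z; apply/forallP=> z'; rewrite ht.
- by apply/forallP=> z; apply/forallP=> z'; rewrite hi.
Qed.

(** Multiplication by the unit [u] permutes the pairs of opposite steps. For even [n] a unit is odd,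
    so every vertex parity shifts by that of [b]. *)
Lemma affine_perm_typ (u b : Zn) (uU : u \is a GRing.unit) z z' :
  (typD z == typD z') = (typD (affine_perm b uU z) == typD (affine_perm b uU z')).
Proof.
case: (EltP z) => [v|x k kU]; case: (EltP z') => [w|y l lU];
  rewrite ?affine_perm_vtx ?affine_perm_edge.
- rewrite !typ_vtx; case: (boolP (odd n)) => // n_even.
  rewrite !odd_affine //.
  by case: (odd b); case: (odd v); case: (odd w).
- by rewrite !typ_vtx_edge.
- by rewrite !typ_edge_vtx.
- by rewrite !typ_edge -mulrN !(inj_eq (mulrI uU)).
Qed.

Lemma affine_perm_correlation (u b : Zn) (uU : u \is a GRing.unit) :
  affine_perm b uU \in Corr.
Proof.
have incVE v x k (kU : k \is a GRing.unit) : incD (vtx v) (edge x kU) =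
    incD (affine_perm b uU (vtx v)) (affine_perm b uU (edge x kU)).
  rewrite affine_perm_vtx affine_perm_edge !inc_vtx_edge -affine_edge mem_imset //.
  exact: affine_inj.
apply/AutGammaP; split; first exact: affine_perm_typ.
move=> z z'; have := affine_perm_typ b uU z z'.
case: (EltP z) => [v|x k kU]; case: (EltP z') => [w|y l lU] // E.
- by move: E; rewrite inc_vtx !affine_perm_vtx inc_vtx => ->.
- by rewrite inc_sym incVE inc_sym.
- by move: E; rewrite inc_edge !affine_perm_edge inc_edge => ->.
Qed.

(** * Every correlation is affine *)

(** Two different base points would give [2 * k = 0], hence [2 = 0], impossible for [n >= 3]. *)
Lemma edge_inj (k : Zn) (kU : k \is a GRing.unit) : injective (fun x => edge x kU).
Proof.
move=> x y /(congr1 val) E.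
have {}E : [set x; x + k] = [set y; y + k].
  by have := congr1 (fun z : Zn + {set Zn} => if z is inr f then f else set0) E.
have := set21 x (x + k); rewrite E !inE => /orP[/eqP //|/eqP xE].
have := set22 x (x + k); rewrite E !inE xE -addrA -[X in _ == X]addr0.
rewrite !(inj_eq (addrI y)) -[X in _ || (_ == X)]addr0 (inj_eq (addrI k)).
rewrite (negPf (unit_Zn_neq0 kU)) orbF -mulr2n -mulr_natr mulrI_eq0; last exact: mulrI.
by rewrite (negPf (@Zn_natr_neq0 2 _)).
Qed.

(** By finiteness [p] permutes the vertices, so an edge cannot go to a vertex; the endpoints of its
    image are then read off from incidence. *)
Lemma correlation_edge (p : {perm Elt n}) (f : Zn -> Zn) :
  p \in Corr -> (forall v, p (vtx v) = vtx (f v)) ->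
  forall x k (kU : k \is a GRing.unit),
    val (p (edge x kU)) = inr (f @: [set x; x + k]).
Proof.
move=> /AutGammaP[_ incp] pf x k kU.
have f_inj : injective f.
  by move=> v w E; apply/vtx_inj/(@perm_inj _ p); rewrite !pf E.
have f_onto w : exists v, w = f v.
  by have /codomP[v ->] := injF_onto f_inj w; exists v.
have := incp _ (edge x kU).
case E: (p (edge x kU)) / (EltP (p (edge x kU))) => [w|y l lU] inc_xk.
  have [v wE] := f_onto w; move: E; rewrite wE -pf => /esym /perm_inj //.
congr inr; apply/setP=> w; have [v ->] := f_onto w.
by rewrite mem_imset // -inc_vtx_edge -pf -inc_xk.
Qed.

(** Reduces every later equality of correlations to a comparison on vertices. *)
Lemma correlation_ext (p q : {perm Elt n}) (f : Zn -> Zn) :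
  p \in Corr -> q \in Corr ->
  (forall v, p (vtx v) = vtx (f v)) -> (forall v, q (vtx v) = vtx (f v)) -> p = q.
Proof.
move=> pC qC pf qf; apply/permP=> z; case: (EltP z) => [v|x k kU].
  by rewrite pf qf.
by apply: val_inj; rewrite !(@correlation_edge _ f).
Qed.

(** The value 0 on edges is a placeholder: the result matters only once [z] is known to be a
    vertex. *)
Definition vtx_of (z : Elt n) : Zn := if val z is inl v then v else 0.

(* If the vertices went to E_k, then for a class E_j other than E_k (j = 1 or 2)
   the preimage of an edge of E_j would be incident to all vertices. *)
Lemma vtx_not_edge_odd (p : {perm Elt n}) v x k (kU : k \is a GRing.unit) :
  (0 < m)%N -> odd n -> p \in Corr -> p (vtx v) <> edge x kU.
Proof.
move=> m_gt0 n_odd /AutGammaP[typp incp] pv.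
have [j [jU jk jNk]] : exists j : Zn, [/\ j \is a GRing.unit, j != k & j != - k].
  have ne21 : 2%:R != 1 :> Zn.
    by rewrite -subr_eq0 mulr2n addrK oner_neq0.
  (* This says [3 != 0] and uses [n > 3]. For [n = 3] the steps 1 and 2 are opposite, and there is
     only one class of edges. *)
  have ne2N1 : 2%:R != - 1 :> Zn.
    by rewrite -addr_eq0 -mulrSr; apply: Zn_natr_neq0; rewrite !ltnS.
  have [/orP E|/norP[]] := boolP ((1 == k) || (1 == - k)); last first.
    by exists 1; rewrite unitr1.
  exists 2%:R; split; first exact: unit2_Zn.
    by case: E => /eqP E; rewrite -?E // -[k]opprK -E.
  by case: E => /eqP E; rewrite -?E // -[k]opprK -E.
have inc_all w : incD (vtx w) (p^-1%g (edge 0 jU)).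
  rewrite incp permKV; have := typp (vtx v) (vtx w).
  rewrite pv typ_vtx n_odd; case: (EltP (p (vtx w))) => [w'|y l lU].
    by rewrite typ_edge_vtx.
  rewrite typ_edge inc_edge typ_edge => /esym/orP E.
  rewrite negb_or; case: E => /eqP E; move: jk jNk; rewrite E ?opprK.
    by rewrite eq_sym => -> /eqP h; apply/eqP => E'; apply: h; rewrite E' opprK.
  move=> h1 h2; rewrite (eq_sym l) h2 /=.
  by apply: contra h1 => /eqP ->; rewrite opprK.
(* No element is incident to all vertices: a vertex is not incident to itself, and an edge has at
   most two endpoints. *)
case: (EltP (p^-1%g (edge 0 jU))) inc_all => [w|y l lU] inc_all.
  by have := inc_all w; rewrite inc_vtx eqxx.
have : [set: Zn] \subset [set y; y + l] by apply/subsetP=> w _; apply: inc_all.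
by move/subset_leq_card; rewrite cardsT card_ord cards2; case: (_ != _).
Qed.

(* If a vertex went to E_k, then E_k would be mapped back injectively into
   vertices of one parity, although it has as many elements as Z_n. *)
Lemma vtx_not_edge_even (p : {perm Elt n}) v x k (kU : k \is a GRing.unit) :
  ~~ odd n -> p \in Corr -> p (vtx v) <> edge x kU.
Proof.
move=> n_even /AutGammaP[typp _] pv.
have pVk y : exists2 w, p^-1%g (edge y kU) = vtx w & odd w = odd v.
  have := typp (vtx v) (p^-1%g (edge y kU)); rewrite permKV pv typ_edge eqxx.
  case: (EltP (p^-1%g (edge y kU))) => [w|y' l lU]; last by rewrite typ_vtx_edge.
  by rewrite typ_vtx (negPf n_even) => /eqP E; exists w.
pose g y := vtx_of (p^-1%g (edge y kU)).
have gE y : p^-1%g (edge y kU) = vtx (g y) /\ odd (g y) = odd v.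
  by rewrite /g; have [w -> ->] := pVk y.
have g_inj : injective g.
  move=> y z E; apply/(@edge_inj k kU)/(@perm_inj _ p^-1%g).
  by rewrite (gE y).1 (gE z).1 E.
(* Injectivity makes [g] onto, but [v + 1] has the wrong parity to be a value. *)
have /codomP[y yE] := injF_onto g_inj (v + 1).
have := (gE y).2; rewrite -yE odd_Zn_add // addbT.
by case: (odd v).
Qed.

Lemma correlation_vtx (p : {perm Elt n}) :
  (0 < m)%N -> p \in Corr -> forall v, p (vtx v) = vtx (vtx_of (p (vtx v))).
Proof.
move=> m_gt0 pC v; case E: (p (vtx v)) / (EltP (p (vtx v))) => [//|x k kU].
have [n_odd|n_even] := boolP (odd n).
  by have := vtx_not_edge_odd m_gt0 n_odd pC E.
by have := vtx_not_edge_even n_even pC E.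
Qed.

Lemma correlation_affine (p : {perm Elt n}) :
  (0 < m)%N -> p \in Corr ->
  exists u b (uU : u \is a GRing.unit), p = affine_perm b uU.
Proof.
move=> m_gt0 pC; set f := fun v => vtx_of (p (vtx v)).
have pf v : p (vtx v) = vtx (f v) by apply: correlation_vtx.
have f_inj : injective f.
  by move=> v w E; apply/vtx_inj/(@perm_inj _ p); rewrite !pf E.
have [typp incp] := AutGammaP _ pC.
have U1 : (1 : Zn) \is a GRing.unit by apply: unitr1.
pose d v := f (v + 1) - f v.
have d_neq0 v : d v != 0.
  rewrite subr_eq0 (inj_eq f_inj) -subr_eq0 addrAC subrr add0r; exact: oner_neq0.
have fd v : f (v + 1) = f v + d v by rewrite [RHS]addrC subrK.
have dE v : exists y l (lU : l \is a GRing.unit),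
    p (edge v U1) = edge y lU /\ (d v = l \/ d v = - l).
  have := correlation_edge pC pf v U1; rewrite imsetU1 imset_set1 fd.
  case: (EltP (p (edge v U1))) => [//|y l lU] E; exists y, l, lU; split=> //.
  apply: (set2_step (d_neq0 v) (x := f v) (y := y)).
  by have := congr1 (fun z : Zn + {set Zn} => if z is inr e then e else set0) E.
have [y0 [l0 [l0U [p0 d0]]]] := dE 0.
(* The edges of E_1 share a type, so their images lie in one class. *)
have d_pm v : d v = d 0 \/ d v = - d 0.
  have [y [l [lU [pv dv]]]] := dE v.
  have := typp (edge v U1) (edge 0 U1); rewrite typ_edge eqxx pv p0 typ_edge.
  by case/esym/orP=> /eqP El; move: dv d0; rewrite El => -[] -> [] ->;
    rewrite ?opprK; by [left | right].
have d0U : d 0 \is a GRing.unit by case: d0 => ->; rewrite ?unitrN.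
(* A change of sign of the step would give f (v + 2) = f v. *)
have d_const (i : nat) : d i%:R = d 0.
  elim: i => [//|i IH]; case: (d_pm i.+1%:R) => // E.
  have : f (i%:R + 1 + 1) = f i%:R.
    by rewrite fd fd IH natr1 E addrK.
  move/f_inj/eqP; rewrite -addrA -[X in _ == X]addr0 (inj_eq (addrI _)).
  by rewrite (negPf (@Zn_natr_neq0 2 _)).
(* Induction on naturals suffices, every residue being of the form [i%:R]. *)
have f_aff (i : nat) : f i%:R = affine (d 0) (f 0) i%:R.
  elim: i => [|i IH]; first by rewrite /affine mulr0 addr0.
  by rewrite -natr1 fd d_const IH /affine; ring.
exists (d 0), (f 0), d0U; apply: (@correlation_ext _ _ f) => //.
  exact: affine_perm_correlation.
by move=> v; rewrite affine_perm_vtx -[v]natr_Zp f_aff.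
Qed.

(** Two test elements decide: the edge from 0 to 1 constrains [u], and the vertex 0 constrains the
    parity of [b] when [n] is even. *)
Lemma affine_perm_AutI (u b : Zn) (uU : u \is a GRing.unit) :
  (affine_perm b uU \in AutIGamma (@typD n) (@incD n)) =
  ((u == 1) || (u == - 1)) && (odd n || ~~ odd b).
Proof.
rewrite inE affine_perm_correlation andTb; apply/forallP/andP.
  have U1 : (1 : Zn) \is a GRing.unit by apply: unitr1.
  move=> typI; split.
    by have := typI (edge 0 U1); rewrite affine_perm_edge typ_edge mulr1.
  have := typI (vtx 0); rewrite affine_perm_vtx typ_vtx.
  by rewrite /affine mulr0 addr0 eqbF_neg.
case=> upm b_even z; case: (EltP z) => [v|x k kU].
  rewrite affine_perm_vtx typ_vtx.
  case: (boolP (odd n)) b_even => // n_even; rewrite orFb => /negPf b_even.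
  by rewrite odd_affine // b_even eqxx.
rewrite affine_perm_edge typ_edge.
by case/orP: upm => /eqP ->; rewrite ?mul1r ?mulN1r ?eqxx ?orbT.
Qed.

End Polygon.

(** * Automorphisms of the dihedral group *)

Section DihedralAutomorphisms.

Variable m : nat.
Local Notation n := m.+3.
Local Notation Zn := 'I_m.+3.
Local Notation Corr := (AutGamma (@typD n) (@incD n)).

(** The group enters only through these properties of two generators; [dihedral_presentation]
    provides them for [dihedral_gtype]. *)
Variables (gT : finGroupType) (x y : gT).
Local Notation G := [set: gT]%G.
Hypotheses (ox : #[x]%g = n) (y2 : (y * y = 1)%g) (xy : (x ^ y = x^-1)%g).
Hypothesis y_notin : y \notin <[x]>%g.
Hypothesis xyT : forall g, g \in <[x]>%g \/ (y * g)%g \in <[x]>%g.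
Local Open Scope group_scope.

Definition rot (v : Zn) : gT := x ^+ v.
Definition refl (v : Zn) : gT := y * rot v.

Lemma rotD v w : rot v * rot w = rot (v + w)%R.
Proof. by rewrite /rot -expgD -(expg_mod_order x (v + w)) ox. Qed.

Lemma rotM (v : Zn) k : rot v ^+ k = rot (v * k%:R)%R.
Proof.
rewrite /rot -expgM -(expg_mod_order x (v * k)) ox Zp_nat.
by rewrite /= modnMmr.
Qed.

Lemma rotN v : rot (- v)%R = (rot v)^-1.
Proof. by apply: (mulgI (rot v)); rewrite rotD subrr mulgV. Qed.

Lemma rot_inj : injective rot.
Proof.
move=> v w /eqP; rewrite /rot eq_expg_mod_order ox !modn_small // => /eqP.
exact: val_inj.
Qed.

Lemma rotJy v : rot v ^ y = rot (- v)%R.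
Proof. by rewrite rotN /rot conjXg xy expgVn. Qed.

Lemma rot_y v : rot v * y = y * rot (- v)%R.
Proof. by rewrite conjgC rotJy. Qed.

Lemma refl_rot v w : refl v * rot w = refl (v + w)%R.
Proof. by rewrite /refl -mulgA rotD. Qed.

Lemma rot_refl v w : rot v * refl w = refl (w - v)%R.
Proof. by rewrite /refl mulgA rot_y -mulgA rotD addrC. Qed.

Lemma refl_refl v w : refl v * refl w = rot (w - v)%R.
Proof. by rewrite /(refl v) -mulgA rot_refl /refl mulgA y2 mul1g. Qed.

Lemma refl_inj : injective refl.
Proof. by move=> v w /mulgI /rot_inj. Qed.

Lemma rot_refl_neq v w : rot v <> refl w.
Proof.
move=> E; case/negP: y_notin.
have -> : y = rot v * (rot w)^-1 by rewrite E /refl mulgK.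
by rewrite groupM ?groupV ?mem_cycle.
Qed.

Variant rot_refl_spec : gT -> Prop :=
  | IsRot v : rot_refl_spec (rot v)
  | IsRefl v : rot_refl_spec (refl v).

Lemma rotreflP g : rot_refl_spec g.
Proof.
have rotP h : h \in <[x]> -> exists v, h = rot v.
  case/cyclePmin=> i; rewrite ox => lt_i ->; by exists (Ordinal lt_i).
case: (xyT g) => /rotP[v E]; first by rewrite E; constructor.
have -> : g = refl v by rewrite -[g]mul1g -y2 -mulgA E.
by constructor.
Qed.

Lemma Aut_setTP (a : {perm gT}) :
  reflect {morph a : g h / g * h} (a \in Aut G).
Proof.
rewrite inE; apply: (iffP andP) => [[_ /morphicP aM] g h|aM].
  by apply: aM; rewrite inE.
by split; [apply/subsetP=> g; rewrite inE | apply/morphicP=> g h _ _].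
Qed.

(** Every rotation is a product of two reflections, so the reflections determine an automorphism. *)
Lemma Aut_ext (a a' : {perm gT}) :
  a \in Aut G -> a' \in Aut G -> (forall v, a (refl v) = a' (refl v)) -> a = a'.
Proof.
move=> /Aut_setTP aM /Aut_setTP aM' E; apply/permP=> g.
case: (rotreflP g) => v //.
by rewrite -[v](addrK 0%R) addr0 -refl_refl aM aM' !E.
Qed.

(** Reflections square to 1 while [x] does not, so [a] and its inverse both send [x] to a rotation.
    The two exponents are inverse to each other, which makes the slope a unit. *)
Lemma Aut_affine (a : {perm gT}) : a \in Aut G ->
  exists u b : Zn, u \is a GRing.unit /\ forall v, a (refl v) = refl (affine u b v).
Proof.
move=> /Aut_setTP aM.
have a1 : a 1 = 1 by apply: (mulgI (a 1)); rewrite -aM !mulg1.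
have aX g k : a (g ^+ k) = a g ^+ k by elim: k => // k IH; rewrite !expgS aM IH.
have x2 : x * x <> 1.
  move/eqP; rewrite -[_ * _]/(x ^+ 2) -order_dvdn ox => /dvdn_leq; lia.
have refl2 v : refl v * refl v = 1 by rewrite refl_refl subrr.
have [j axE] : exists j, a x = rot j.
  case E: (a x) / (rotreflP (a x)) => [j|j]; first by exists j.
  by case: x2; apply: (@perm_inj _ a); rewrite aM E refl2 a1.
have arot v : a (rot v) = rot (j * v)%R by rewrite /rot aX axE rotM natr_Zp.
have [i ji] : exists i, (j * i = 1)%R.
  have rot1 : rot 1%R = x by [].
  case E: (a^-1 x) / (rotreflP (a^-1 x)) => [i|i]; last first.
    by case: x2; rewrite -[x](permKV a) E -aM refl2 a1.
  by exists i; apply: rot_inj; rewrite -arot -E permKV rot1.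
have jU : j \is a GRing.unit.
  by apply/unitrPr; exists i.
have y0 : y = refl 0%R by rewrite /refl mulg1.
(* Every rotation is already the image of a rotation, so [a y] is a reflection. *)
have [b ayE] : exists b, a y = refl b.
  case E: (a y) / (rotreflP (a y)) => [b|b]; last by exists b.
  have : a y = a (rot (j^-1 * b)%R) by rewrite arot mulVKr.
  by move/perm_inj; rewrite y0 => /esym/rot_refl_neq.
exists j, b; split=> // v.
by rewrite aM ayE arot refl_rot.
Qed.

Lemma affine_Aut (u b : Zn) : u \is a GRing.unit ->
  exists2 a, a \in Aut G & forall v, a (refl v) = refl (affine u b v).
Proof.
move=> uU.
(* For a reflection [g], the product [y * g] recovers its rotation part, which is raised to the
   power [u]. *)
pose F g := if g \in <[x]> then g ^+ u else y * rot b * (y * g) ^+ u.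
have Frot v : F (rot v) = rot (u * v)%R.
  by rewrite /F mem_cycle rotM natr_Zp mulrC.
have Frefl v : F (refl v) = refl (affine u b v).
  rewrite /F; case: ifP => [/cyclePmin[i]|_].
    by rewrite ox => lt_i /esym /(@rot_refl_neq (Ordinal lt_i)).
  rewrite /refl (mulgA y y) y2 mul1g rotM natr_Zp -mulgA rotD.
  by rewrite /affine (mulrC u).
have F_inj : injective F.
  move=> g h; case: (rotreflP g) => v; case: (rotreflP h) => w; rewrite ?Frot ?Frefl.
  - by move/rot_inj/(mulrI uU)->.
  - by move/rot_refl_neq.
  - by move/esym/rot_refl_neq.
  - by move/refl_inj/(affine_inj uU)->.
exists (perm F_inj) => [|v]; last by rewrite permE.
apply/Aut_setTP=> g h; rewrite !permE.
case: (rotreflP g) => v; case: (rotreflP h) => w;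
  rewrite ?(rotD, rot_refl, refl_rot, refl_refl, Frot, Frefl) /affine;
  congr (_ _); ring.
Qed.

(** * Inner automorphisms *)

Lemma conj_rot v w : refl v ^ rot w = refl (v + (w + w))%R.
Proof. by rewrite conjgE refl_rot -rotN rot_refl opprK addrA. Qed.

Lemma conj_refl v w : refl v ^ refl w = refl (w + w - v)%R.
Proof.
have -> : refl v ^ refl w = refl w * refl v * refl w.
  rewrite conjgE mulgA; congr (_ * _ * _); apply/eqP.
  by rewrite eq_invg_mul refl_refl subrr.
by rewrite refl_refl rot_refl; congr refl; ring.
Qed.

Lemma Inn_sub_Aut : Inn G \subset Aut G.
Proof. by apply/subsetP=> _ /imsetP[g _ ->]; apply: Aut_aut. Qed.

(** Conjugation by [rot c] turns the label [v] into [v + 2c], and by [refl c] into [2c - v]. The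
    doubles [2c] are all residues for odd [n] and the even ones for even [n], which matches
    [affine_perm_AutI]. *)
Lemma affine_Inn (a : {perm gT}) (u b : Zn) :
  a \in Aut G -> u \is a GRing.unit -> (forall v, a (refl v) = refl (affine u b v)) ->
  (a \in Inn G) = ((u == 1) || (u == - 1))%R && (odd n || ~~ odd b).
Proof.
move=> aA uU aE; apply/imsetP/andP.
  case=> g _ ag.
  have aJ v : refl (affine u b v) = refl v ^ g by rewrite -aE ag conj_autE ?inE.
  suff [upm [c bE]] : ((u == 1) || (u == -1))%R /\ exists c, b = (c + c)%R.
    split=> //; case: (boolP (odd n)) => // n_even.
    by rewrite bE odd_Zn_add // addbb.
  have bE : affine u b 0%R = b by rewrite /affine mulr0 addr0.
  have uE : (u = affine u b 1%R - b)%R by rewrite /affine mulr1 addrC addKr.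
  case: (rotreflP g) aJ => c aJ.
    have aff v : (affine u b v = v + (c + c))%R.
      by apply: refl_inj; rewrite aJ conj_rot.
    have b2 : (b = c + c)%R by rewrite -bE aff add0r.
    by split; [rewrite uE aff b2 addrK eqxx | exists c].
  have aff v : (affine u b v = c + c - v)%R.
    by apply: refl_inj; rewrite aJ conj_refl.
  have b2 : (b = c + c)%R by rewrite -bE aff subr0.
  by split; [rewrite uE aff b2 addrAC subrr add0r eqxx orbT | exists c].
case=> upm b_even.
(* For even [n] the integer representing [b] is halved; for odd [n] the residue is divided by the
   unit 2. *)
have [c bE] : exists c, b = (c + c)%R.
  case: (boolP (odd n)) b_even => [n_odd _|_]; last first.
    rewrite orFb => b_even; exists (inZp b./2).
    by apply: val_inj; rewrite /= modnDm addnn even_halfK // modn_small.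
  by exists (b / 2%:R)%R; rewrite -mulr2n -[RHS]mulr_natr divrK // unit2_Zn.
have [/eqP u1|/eqP u1] := orP upm.
  exists (rot c); rewrite ?inE //; apply: Aut_ext => // [|v]; first exact: Aut_aut.
  by rewrite aE conj_autE ?inE // conj_rot u1 bE /affine mul1r addrC.
exists (refl c); rewrite ?inE //; apply: Aut_ext => // [|v]; first exact: Aut_aut.
by rewrite aE conj_autE ?inE // conj_refl u1 bE /affine mulN1r.
Qed.

(** * The representation *)

(** Choosing a correlation by its action on vertices yields a total function without selecting [u]
    and [b]. On [Aut G] the choice exists and is unique, so the default 1 is not reached there. *)
Definition Aut_action (a : {perm gT}) : {perm Elt n} :=
  odflt 1 [pick p in Corr |
    [forall v, forall w, (a (refl v) == refl w) ==> (p (vtx v) == vtx w)]].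

Lemma Aut_actionE (a : {perm gT}) (u b : Zn) (uU : u \is a GRing.unit) :
  (forall v, a (refl v) = refl (affine u b v)) -> Aut_action a = affine_perm b uU.
Proof.
move=> aE; rewrite /Aut_action; case: pickP => [p|/(_ (affine_perm b uU))] /=.
  case/andP=> pC /forallP pE.
  apply: (correlation_ext (f := affine u b)) => //.
  - exact: affine_perm_correlation.
  - by move=> v; move/forallP/(_ (affine u b v)): (pE v); rewrite aE eqxx => /eqP.
  - exact: affine_perm_vtx.
rewrite affine_perm_correlation => /negP[]; apply/forallP=> v; apply/forallP=> w.
by apply/implyP; rewrite aE affine_perm_vtx => /eqP/refl_inj ->.
Qed.

Lemma Aut_actionP (a : {perm gT}) : a \in Aut G ->
  exists u b (uU : u \is a GRing.unit),
    (forall v, a (refl v) = refl (affine u b v)) /\ Aut_action a = affine_perm b uU.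
Proof.
move=> /Aut_affine[u [b [uU aE]]]; exists u, b, uU; split=> //.
exact: Aut_actionE.
Qed.

Lemma Aut_actionM : {in Aut G &, {morph Aut_action : a a' / a * a'}}.
Proof.
(* The parameters of the product are obtained abstractly; both sides are correlations, so comparing
   them on vertices avoids composing affine formulas. *)
move=> a1 a2 A1 A2; have := Aut_actionP (groupM A1 A2).
case=> u3 [b3 [u3U [E3 ->]]].
have [u1 [b1 [u1U [E1 ->]]]] := Aut_actionP A1.
have [u2 [b2 [u2U [E2 ->]]]] := Aut_actionP A2.
apply: (correlation_ext (f := affine u3 b3)).
- exact: affine_perm_correlation.
- have /AutGammaP[t1 i1] := affine_perm_correlation b1 u1U.
  have /AutGammaP[t2 i2] := affine_perm_correlation b2 u2U.
  by apply/AutGammaP; split=> z z'; rewrite !permM -?t2 -?t1 -?i2 -?i1.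
- exact: affine_perm_vtx.
- move=> v; rewrite permM !affine_perm_vtx; congr vtx.
  by apply: refl_inj; rewrite -E2 -E1 -E3 permM.
Qed.

Lemma Aut_action_inj : {in Aut G &, injective Aut_action}.
Proof.
move=> a1 a2 A1 A2.
have [u1 [b1 [u1U [E1 ->]]]] := Aut_actionP A1.
have [u2 [b2 [u2U [E2 ->]]]] := Aut_actionP A2 => E.
apply: Aut_ext => // v; rewrite E1 E2; congr refl; apply: (@vtx_inj m).
by rewrite -(affine_perm_vtx b1 u1U) E affine_perm_vtx.
Qed.

Lemma Aut_action_correlation : Aut_action @: Aut G \subset Corr.
Proof.
apply/subsetP=> _ /imsetP[a /Aut_actionP[u [b [uU [_ ->]]]] ->].
exact: affine_perm_correlation.
Qed.

Lemma Inn_action_typ : Aut_action @: Inn G \subset AutIGamma (@typD n) (@incD n).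
Proof.
apply/subsetP=> _ /imsetP[a aI ->]; have aA := subsetP Inn_sub_Aut _ aI.
have [u [b [uU [aE ->]]]] := Aut_actionP aA.
by rewrite affine_perm_AutI -(affine_Inn aA uU aE).
Qed.

Lemma dihedral_weak_rep : weak_inc_geom_rep G (@typD n) (@incD n).
Proof.
split; first exact: Inn_sub_Aut.
exists Aut_action; split.
- exact: Aut_actionM.
- exact: Aut_action_inj.
- exact: Aut_action_correlation.
- exact: Inn_action_typ.
Qed.

(** Surjectivity comes from [correlation_affine], where [n > 3] enters, and from [affine_Aut]; the
    type-preserving part follows because both sides impose the same condition on [(u, b)]. *)
Lemma dihedral_rep : (0 < m)%N -> inc_geom_rep G (@typD n) (@incD n).
Proof.
move=> m_gt0; split; first exact: Inn_sub_Aut.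
exists Aut_action; split.
- exact: Aut_actionM.
- exact: Aut_action_inj.
- apply/eqP; rewrite eqEsubset Aut_action_correlation; apply/subsetP=> p pC.
  have [u [b [uU ->]]] := correlation_affine m_gt0 pC.
  have [a aA aE] := affine_Aut b uU.
  by apply/imsetP; exists a; rewrite ?(Aut_actionE uU aE).
- apply/eqP; rewrite eqEsubset Inn_action_typ; apply/subsetP=> p pI.
  have pC : p \in Corr by move: pI; rewrite inE => /andP[].
  have [u [b [uU pE]]] := correlation_affine m_gt0 pC.
  have [a aA aE] := affine_Aut b uU.
  apply/imsetP; exists a; last by rewrite (Aut_actionE uU aE).
  by rewrite (affine_Inn aA uU aE) -(affine_perm_AutI b uU) -pE.
Qed.

End DihedralAutomorphisms.

(** * Generators of the dihedral group and conclusion *)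

Lemma dihedral_presentation (q : nat) : (2 < q)%N ->
  exists x y : dihedral_gtype (2 * q),
    [/\ #[x]%g = q, (y * y = 1)%g, (x ^ y = x^-1)%g, y \notin <[x]>%g
      & forall g, g \in <[x]>%g \/ (y * g)%g \in <[x]>%g].
Proof.
move=> q_gt2; have q_gt1 := ltnW q_gt2; rewrite mul2n.
have [_ /existsP[[x y] /= /eqP[defG xq y2 xy]]] :=
  isoGrpP _ (Grp_dihedral q_gt1) (isog_refl [set: dihedral_gtype q.*2]%G).
have oG : #|[set: dihedral_gtype q.*2]| = q.*2 by rewrite card_dihedral.
have nXY : <[y]>%g \subset 'N(<[x]>)%g.
  by rewrite cycle_subG; apply/normP; rewrite -cycleJ xy cycleV.
move: defG; rewrite norm_joinEr // => defG.
have le_x : (#[x]%g <= q)%N by rewrite dvdn_leq ?order_dvdn ?xq // ltnW.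
have le_y : (#[y]%g <= 2)%N by rewrite dvdn_leq ?order_dvdn ?y2.
have ox : #[x]%g = q.
  (* The relations bound the orders by [q] and 2, while the product of the two cyclic groups has
     [2q] elements, so [x] attains its bound. *)
  have := mul_cardG <[x]> <[y]>; rewrite defG oG -!orderE.
  have : (0 < #|<[x]> :&: <[y]>|)%N%g by apply: cardG_gt0.
  by move: le_x le_y; move: #|_| => c; nia.
have yy : (y * y = 1)%g by rewrite -[RHS]y2.
exists x, y; split=> // [|g].
  apply/negP; rewrite -cycle_subG => /mulGSid xE.
  by move: oG; rewrite -defG xE -orderE ox; lia.
have : g \in [set: dihedral_gtype q.*2] by rewrite inE.
rewrite -defG => /mulsgP[h k hx /cyclePmin[i lt_i ->] ->].
case: i lt_i => [|[|i]] lt_i; last by lia.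
  by left; rewrite mulg1.
(* As [y] is its own inverse, this product is a conjugate of [h] and stays in the normalised
   subgroup. *)
right; have -> : (y * (h * y ^+ 1) = h ^ y)%g.
  by rewrite conjgE expg1; congr (_ * _)%g; apply/esym/eqP; rewrite eq_invg_mul yy.
by rewrite memJ_norm // -cycle_subG.
Qed.

Theorem mainTheorem1 (n : nat) (hn : 3 <= n) :
  (3 < n -> inc_geom_rep (Dih n) (@typD n) (@incD n)) /\
  (n = 3 -> weak_inc_geom_rep (Dih n) (@typD n) (@incD n)).
Proof.
case: n hn => [|[|[|m]]] // hn.
have [x [y [ox y2 xy y_notin xyT]]] := dihedral_presentation hn.
split=> [m_gt0|_]; first by apply: (dihedral_rep ox y2 xy y_notin xyT); lia.
exact: (dihedral_weak_rep ox y2 xy y_notin xyT).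
Qed.
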